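(* Let $\lambda_{ij}>0$, $i,j=1,\dots,k$, $i\ne j$, be arbitrary, and assume that the testing problem is truncatable. Let $\psi$ be a stopping rule satisfying $$I_{\{l_m<f_\theta^m+R_m\}}\le\psi_m\le I_{\{l_m\le f_\theta^m+R_m\}}\quad\mu^m\text{-almost everywhere on } C_m^\psi\qquad( * )$$ for all $m=1,2,\dots$ (where $l_m$ and $R_m$ are built from these $\lambda_{ij}$), and let $\phi$ be any decision rule satisfying $$\phi_n^j\le I_{\left\{\sum_{i\ne j}\lambda_{ij}f_{\theta_i}^n=l_n\right\}}\quad\text{for all } j=1,\dots,k,\ \mu^n\text{-almost everywhere on } S_n^\psi,\ \text{for all } n=1,2,\dots.$$ Then for all sequential tests $(\psi',\phi')$ such that $$\alpha_{ij}(\psi',\phi')\le\alpha_{ij}(\psi,\phi)\quad\text{for all } i,j=1,\dots,k,\ i\ne j,\qquad( ** )$$ it holds that $$N(\psi')\ge N(\psi).\qquad( *** )$$ The inequality in $( *** )$ is strict if at least one of the inequalities in $( ** )$ is strict. If there are equalities in all of the inequalities in $( ** )$ and $( *** )$, then $\psi'$ satisfies $( * )$ for all $m=1,2,\dots$ as well (with $\psi'$ instead of $\psi$).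
   Context: Setting. Let $k\ge2$ and let $X_1,X_2,\dots$ be a discrete-time stochastic process with values in a measurable space $\mathcal X$, whose distribution $P_\vartheta$ depends on a parameter $\vartheta$. Let $\mu$ be a $\sigma$-finite measure on $\mathcal X$ and $\mu^n=\mu\otimes\cdots\otimes\mu$ ($n$ times). For every parameter value $\vartheta$ and every $n\ge 1$, under $P_\vartheta$ the vector $(X_1,\dots,X_n)$ has density $f_\vartheta^n(x_1,\dots,x_n)$ with respect to $\mu^n$ (in particular $\int f_\vartheta^{n+1}d\mu(x_{n+1})=f_\vartheta^n$ $\mu^n$-a.e.). Parameter values $\theta_1,\dots,\theta_k$ (the hypotheses $H_i:\theta=\theta_i$) and one more fixed parameter value $\theta$ (not necessarily one of the $\theta_i$) are given. For a function $F_n=F_n(x_1,\dots,x_n)$, $E_\vartheta F_n=E_\vartheta F_n(X_1,\dots,X_n)=\int F_n f^n_\vartheta\,d\mu^n$. A stopping rule is a sequence $\psi=(\psi_1,\psi_2,\dots)$ of measurable functions $\psi_n=\psi_n(x_1,\dots,x_n)$ with values in $[0,1]$. A decision rule is a sequence $\phi=(\phi_1,\phi_2,\dots)$, $\phi_n=(\phi_n^1,\dots,\phi_n^k)$, of measurable functions of $(x_1,\dots,x_n)$ with $\phi_n^i\ge0$ and $\sum_{i=1}^k\phi_n^i=1$. A sequential test is a pair $(\psi,\phi)$. The stopping time $\tau_\psi$ has distribution $P_\vartheta(\tau_\psi=n)=E_\vartheta(1-\psi_1)\cdots(1-\psi_{n-1})\psi_n$, and $P_\vartheta(\tau_\psi<\infty)=\sum_{n\ge1}P_\vartheta(\tau_\psi=n)$.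 Error probabilities: $\alpha_{ij}(\psi,\phi)=\sum_{n=1}^\infty E_{\theta_i}(1-\psi_1)\cdots(1-\psi_{n-1})\psi_n\phi_n^j$. Average sample number: $N(\psi)=E_\theta\tau_\psi=\sum_{n=1}^\infty nP_\theta(\tau_\psi=n)$ if $P_\theta(\tau_\psi<\infty)=1$, and $N(\psi)=\infty$ otherwise. Given $\lambda_{ij}$, put $l_n=\min_{1\le j\le k}\sum_{i\ne j}\lambda_{ij}f^n_{\theta_i}$ (in $\sum_{i\ne j}$, $j$ is fixed and $i$ runs over $\{1,\dots,k\}\setminus\{j\}$). The testing problem is called truncatable if $\int(1-\psi_1)\cdots(1-\psi_{n-1})\,l_n\,d\mu^n\to0$ as $n\to\infty$ for every stopping rule $\psi$ with $E_\theta\tau_\psi<\infty$. For $N\ge1$ put $V_N^N\equiv l_N$ and, recursively for $m=N-1,\dots,1$, $V_m^N=\min\{l_m,\ f_\theta^m+\int V_{m+1}^N(x_1,\dots,x_{m+1})\,d\mu(x_{m+1})\}$. For fixed $m$ the sequence $V_m^N$ is non-increasing in $N\ge m$; $V_m=\lim_{N\to\infty}V_m^N$. $R_m=R_m(x_1,\dots,x_m)=\int V_{m+1}(x_1,\dots,x_{m+1})\,d\mu(x_{m+1})$. $C_n^\psi=\{(x_1,\dots,x_n):(1-\psi_1(x_1))\cdots(1-\psi_{n-1}(x_1,\dots,x_{n-1}))>0\}$ (with the empty product equal to $1$ for $n=1$); $S_n^\psi=\{(x_1,\dots,x_n):(1-\psi_1)\cdots(1-\psi_{n-1})\psi_n>0\}$.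 $I_A$ is the indicator function of $A$. *)

(* Defs.v *)
From HB Require Import structures.
From mathcomp Require Import all_boot all_order all_algebra.
From mathcomp Require Import all_classical all_reals all_analysis.
Set Implicit Arguments.
Unset Strict Implicit.
Unset Printing Implicit Defensive.
Import Order.TTheory GRing.Theory Num.Theory.
Import numFieldNormedType.Exports.
Local Open Scope classical_set_scope.
Local Open Scope ring_scope.

(* Conventions.  The space of (x_1, ..., x_n) is n.-tuple T with the library's
   product sigma-algebra; a sequence of functions F_n(x_1, ..., x_n), n >= 1, is
   F : forall n, n.-tuple T -> _, and its value at n = 0 is neither constrained
   nor used.  Likewise the process is X_1, X_2, ...: X 0 is
   unused.  Values that may be infinite live in \bar R. *)

Section PowerMeasure.
Context d (T : measurableType d) (R : realType).

Definition rcons_pair (n : nat) (p : n.-tuple T * T) : n.+1.-tuple T :=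
  [tuple of rcons p.1 p.2].

Lemma measurable_rcons_pair (n : nat) :
  measurable_fun [set: n.-tuple T * T] (@rcons_pair n).
Proof.
apply/measurable_fun_tnthP => i.
have [ltin | leni] := ltnP i n.
  rewrite (_ : _ \o _ = (fun t => tnth t (Ordinal ltin)) \o fst).
    by apply: measurableT_comp => //; exact: measurable_tnth.
  apply/funext => -[t y] /=.
  by rewrite !(tnth_nth y) /= nth_rcons size_tuple ltin.
rewrite (_ : _ \o _ = snd) //.
apply/funext => -[t y] /=.
have -> : i = ord_max by apply/val_inj/anti_leq; rewrite /= leni -ltnS ltn_ord.
by rewrite (tnth_nth y) /= nth_rcons size_tuple ltnn eqxx.
Qed.

Section Snoc.
Variables (n : nat) (nu : {measure set (n.-tuple T) -> \bar R}).
Variable mu : {sigma_finite_measure set T -> \bar R}.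

(* nu (x) mu, carried over to (n+1)-tuples *)
Definition snoc_measure : set (n.+1.-tuple T) -> \bar R :=
  pushforward (nu \x mu)%E (@rcons_pair n).

Let mrcons : measurable_fun [set: n.-tuple T * T] (@rcons_pair n).
Proof. exact: measurable_rcons_pair. Qed.

Let snoc_measure0 : snoc_measure set0 = 0%E.
Proof. exact: measure0. Qed.

Let snoc_measure_ge0 A : (0 <= snoc_measure A)%E.
Proof. exact: measure_ge0. Qed.

Let snoc_measure_sigma_additive : semi_sigma_additive snoc_measure.
Proof. exact: measure_semi_sigma_additive. Qed.

HB.instance Definition _ := isMeasure.Build _ _ _ snoc_measure
  snoc_measure0 snoc_measure_ge0 snoc_measure_sigma_additive.
End Snoc.

(* mu^n; the unit mass on the one-point space of empty tuples starts the
   recursion mu^(n+1) = mu^n (x) mu. *)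
Fixpoint power_measure (mu : {sigma_finite_measure set T -> \bar R}) (n : nat)
    : {measure set (n.-tuple T) -> \bar R} :=
  match n with
  | 0%N => \d_([tuple] : 0.-tuple T)
  | n'.+1 => snoc_measure (power_measure mu n') mu
  end.

End PowerMeasure.

Section Model.
Context d (T : measurableType d) (R : realType).
Context d' (Omega : measurableType d').

Definition observation (X : nat -> Omega -> T) (n : nat) (w : Omega)
    : n.-tuple T := [tuple X i.+1 w | i < n].

Definition has_densities (mu : {sigma_finite_measure set T -> \bar R})
    (P : probability Omega R) (X : nat -> Omega -> T)
    (f : forall n, n.-tuple T -> R) : Prop :=
  forall n, (0 < n)%N ->
    [/\ measurable_fun [set: n.-tuple T] (f n),
        (forall x, 0 <= f n x)
      & forall A : set (n.-tuple T), measurable A ->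
          P (observation X n @^-1` A) =
          (\int[power_measure mu n]_(x in A) (f n x)%:E)%E].

End Model.

Section SequentialTests.
Context d (T : measurableType d) (R : realType).

Definition stopping_rule (psi : forall n, n.-tuple T -> R) : Prop :=
  forall n, (0 < n)%N ->
    measurable_fun [set: n.-tuple T] (psi n) /\
    (forall x, 0 <= psi n x <= 1).

Definition decision_rule (k : nat) (phi : forall n, 'I_k -> n.-tuple T -> R)
    : Prop :=
  forall n, (0 < n)%N ->
    [/\ (forall j, measurable_fun [set: n.-tuple T] (phi n j)),
        (forall j x, 0 <= phi n j x)
      & (forall x, \sum_(j < k) phi n j x = 1)].

(* (1 - psi_1) ... (1 - psi_(n-1)) as a function of (x_1, ..., x_n).  The
   prefix (x_1, ..., x_i) has type (minn i n).-tuple T, where minn i n = i. *)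
Definition continuation (psi : forall n, n.-tuple T -> R) (n : nat)
    (x : n.-tuple T) : R :=
  \prod_(1 <= i < n) (1 - psi (minn i n) [tuple of take i x]).

Definition stopping_at (psi : forall n, n.-tuple T -> R) (n : nat)
    (x : n.-tuple T) : R :=
  continuation psi x * psi n x.

Definition Cset (psi : forall n, n.-tuple T -> R) (n : nat)
    : set (n.-tuple T) :=
  [set x | 0 < continuation psi x].

Definition Sset (psi : forall n, n.-tuple T -> R) (n : nat)
    : set (n.-tuple T) :=
  [set x | 0 < stopping_at psi x].

End SequentialTests.

Section Characteristics.
Context d (T : measurableType d) (R : realType).
Context d' (Omega : measurableType d').
Local Open Scope ereal_scope.

Definition Eobs (P : probability Omega R) (X : nat -> Omega -> T) (n : nat)
    (F : n.-tuple T -> R) : \bar R :=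
  'E_P[fun w => F (observation X n w)].

Definition prob_stop_at (P : probability Omega R) (X : nat -> Omega -> T)
    (psi : forall n, n.-tuple T -> R) (n : nat) : \bar R :=
  Eobs P X (@stopping_at _ _ _ psi n).

Definition prob_stop (P : probability Omega R) (X : nat -> Omega -> T)
    (psi : forall n, n.-tuple T -> R) : \bar R :=
  \sum_(1 <= n <oo) prob_stop_at P X psi n.

Definition average_sample_number (P : probability Omega R)
    (X : nat -> Omega -> T) (psi : forall n, n.-tuple T -> R) : \bar R :=
  if prob_stop P X psi == 1 then
    \sum_(1 <= n <oo) n%:R%:E * prob_stop_at P X psi n
  else +oo.

(* alpha_ij when P = P_(theta_i) *)
Definition error_prob (P : probability Omega R) (X : nat -> Omega -> T)
    (k : nat) (psi : forall n, n.-tuple T -> R)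
    (phi : forall n, 'I_k -> n.-tuple T -> R) (j : 'I_k) : \bar R :=
  \sum_(1 <= n <oo)
    Eobs P X (fun x : n.-tuple T => stopping_at psi x * phi n j x)%R.

End Characteristics.

Section OptimalStopping.
Context d (T : measurableType d) (R : realType).
Local Open Scope ereal_scope.

(* sum_(i != j) lambda_ij f^n_(theta_i) *)
Definition decision_loss (k : nat) (lambda : 'I_k -> 'I_k -> R)
    (fH : 'I_k -> forall n, n.-tuple T -> R) (j : 'I_k) (n : nat)
    (x : n.-tuple T) : \bar R :=
  (\sum_(i < k | i != j) lambda i j * fH i n x)%R%:E.

(* l_n; +oo is only the neutral element of the minimum. *)
Definition min_loss (k : nat) (lambda : 'I_k -> 'I_k -> R)
    (fH : 'I_k -> forall n, n.-tuple T -> R) (n : nat)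
    (x : n.-tuple T) : \bar R :=
  \big[Order.min/+oo]_(j < k) decision_loss lambda fH j x.

Variables (mu : {sigma_finite_measure set T -> \bar R}).
Variables (l : forall n, n.-tuple T -> \bar R).
Variables (f : forall n, n.-tuple T -> R).

(* V_m^(m + r) *)
Fixpoint backward (r m : nat) (x : m.-tuple T) : \bar R :=
  match r with
  | 0%N => l x
  | r'.+1 => Order.min (l x)
      ((f x)%:E + \int[mu]_y backward r' [tuple of rcons x y])
  end.

(* V_m^N, meant for m <= N *)
Definition Vtrunc (N m : nat) (x : m.-tuple T) : \bar R := backward (N - m) x.

Definition Vlim (m : nat) (x : m.-tuple T) : \bar R :=
  limn (fun N => Vtrunc N x).

Definition Rcont (m : nat) (x : m.-tuple T) : \bar R :=
  \int[mu]_y Vlim [tuple of rcons x y].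

Definition threshold_stopping (psi : forall n, n.-tuple T -> R) : Prop :=
  forall m, (0 < m)%N ->
    {ae power_measure mu m, forall x, Cset psi x ->
      (\1_[set z : m.-tuple T | (l z < (f z)%:E + Rcont z)%E] x <= psi m x
         <= \1_[set z : m.-tuple T | (l z <= (f z)%:E + Rcont z)%E] x)%R}.

End OptimalStopping.

Definition min_loss_decision d (T : measurableType d) (R : realType)
    (mu : {sigma_finite_measure set T -> \bar R}) (k : nat)
    (lambda : 'I_k -> 'I_k -> R) (fH : 'I_k -> forall n, n.-tuple T -> R)
    (psi : forall n, n.-tuple T -> R) (phi : forall n, 'I_k -> n.-tuple T -> R)
    : Prop :=
  forall n (j : 'I_k), (0 < n)%N ->
    {ae power_measure mu n, forall x, Sset psi x ->
      phi n j x <= \1_[set z : n.-tuple T |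
        decision_loss lambda fH j z = min_loss lambda fH z] x}.

Definition truncatable d (T : measurableType d) (R : realType)
    d' (Omega : measurableType d') (mu : {sigma_finite_measure set T -> \bar R})
    (P : probability Omega R) (X : nat -> Omega -> T)
    (l : forall n, n.-tuple T -> \bar R) : Prop :=
  forall psi : forall n, n.-tuple T -> R, stopping_rule psi ->
    (average_sample_number P X psi < +oo)%E ->
    (fun n => \int[power_measure mu n]_x ((continuation psi x)%:E * l n x))%E
      @ \oo --> 0%E.

(* Main.v *)
Require Import Defs.
From HB Require Import structures.
From mathcomp Require Import all_boot all_order all_algebra.
From mathcomp Require Import all_classical all_reals all_analysis.
From mathcomp Require Import measurable_realfun.
From mathcomp Require Import ring.
Set Implicit Arguments.
Unset Strict Implicit.
Unset Printing Implicit Defensive.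
Import Order.TTheory GRing.Theory Num.Theory.
Import numFieldNormedType.Exports.
Local Open Scope classical_set_scope.
Local Open Scope ring_scope.

(** The proof is a Lagrange multiplier argument. To a test assign the cost
    [N(psi) + \sum_(i != j) lambda_ij * alpha_ij(psi, phi)]. The given test
    minimizes this cost among all tests with finite mean sample number, and the
    minimum is finite; a test whose errors are not larger can therefore not
    have a smaller mean sample number, a strict gain in some error has to be
    paid for because the multipliers are positive, and equality everywhere
    makes the competing test a minimizer too.

    For a fixed stopping rule, the weighted errors are minimized by deciding
    for a hypothesis of least loss, which turns them into the expected stopping
    losses [\sum_n \int s_n * l_n], where [s_n] is the weight of stopping at
    [n] ([stopped_loss_le_weighted_error], [weighted_error_min_loss]). The mean
    sample number is the sum of the probabilities of reaching stage [n]
    ([average_sample_numberE]), that is [\sum_n \int c_n * f_n] with [c_n] the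
    continuation weight. What remains is an optimal stopping problem.

    For that problem, let [truncated_cost n] be the cost of using [psi] before
    stage [n] and of behaving optimally afterwards, as measured by the limit
    [V] of the backward recursion. It starts from a value independent of [psi],
    the optimal cost. Since [V] solves Bellman's equation
    [V = min (l, f + \int V)] almost everywhere ([ae_Bellman]), passing from
    stage [n] to stage [n.+1] adds precisely the integral of [c_n] times a
    nonnegative regret ([truncated_costS]), and the regret vanishes exactly
    where [psi] obeys the threshold condition ([regret_integral_eq0P]). Hence a
    threshold rule has total cost at most the optimal one
    ([total_cost_threshold]). Conversely truncatability makes the total cost of
    any rule with finite mean sample number an upper bound of its truncated
    costs ([truncated_cost_le_total]), hence at least the optimal cost; if the
    two coincide, all regrets vanish ([optimal_threshold]). *)

(** * Integrals with respect to a measure with a density *)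

Section Density.
Context d (T : measurableType d) (R : realType).
Local Open Scope ereal_scope.
Import HBNNSimple.

(** Both sides are monotone limits over simple functions approximating [F], so
    the claim reduces to indicators, where it is the hypothesis on [nu]. *)
Lemma ge0_integral_density (nu m : {measure set T -> \bar R}) (g : T -> R) :
    measurable_fun [set: T] g -> (forall x, (0 <= g x)%R) ->
    (forall A, measurable A -> nu A = \int[m]_(x in A) (g x)%:E) ->
  forall F : T -> \bar R, measurable_fun setT F -> (forall x, 0 <= F x) ->
  \int[nu]_x F x = \int[m]_x (F x * (g x)%:E).
Proof.
move=> mg g0 nuE F mF F0.
have mgE : measurable_fun setT (EFin \o g) by exact/measurable_EFinP.
pose h := nnsfun_approx measurableT mF.
have hF x : (h n x)%:E @[n --> \oo] --> F x.
  exact: (cvg_nnsfun_approx measurableT mF).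
have -> : F = fun x => limn (fun n => (h n x)%:E).
  by apply/funext => x; apply/esym/cvg_lim => //; exact: hF.
have -> : (fun x => limn (fun n => (h n x)%:E) * (g x)%:E) =
    fun x => limn (fun n => (h n x)%:E * (g x)%:E).
  apply/funext => x; apply/esym/cvg_lim => //.
  by rewrite (cvg_lim _ (hF x))//; apply: cvgeZr; [|exact: hF].
rewrite monotone_convergence//; last 3 first.
- by move=> n; exact/measurable_EFinP.
- by move=> n x _; rewrite lee_fin.
- by move=> x _ a b ab; rewrite lee_fin; exact/lefP/nd_nnsfun_approx.
rewrite monotone_convergence//; last 3 first.
- by move=> n; apply: emeasurable_funM => //; exact/measurable_EFinP.
- by move=> n x _; rewrite mule_ge0 ?lee_fin.
- move=> x _ a b ab; rewrite lee_wpmul2r ?lee_fin//.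
  exact/lefP/nd_nnsfun_approx.
congr (limn _); apply/funext => n.
have hE x : (h n x)%:E =
    \sum_(y \in range (h n)) (y%:E * (\1_(h n @^-1` [set y]) x)%:E).
  by rewrite fimfunE -fsumEFin.
have ind0 y x : 0 <= y%:E * (\1_(h n @^-1` [set y]) x)%:E.
  by rewrite -EFinM; exact: nnfun_muleindic_ge0.
have indm y : measurable_fun setT
    (fun x => y%:E * (\1_(h n @^-1` [set y]) x)%:E).
  by apply: measurable_funeM; exact/measurable_EFinP.
under eq_integral do rewrite hE.
under [RHS]eq_integral => x _.
  rewrite hE ge0_mule_fsuml; last by move=> y; exact: ind0.
  over.
rewrite ge0_integral_fsum// ge0_integral_fsum//; last 2 first.
- by move=> y; apply: (emeasurable_funM (indm y)); exact: mgE.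
- by move=> y z _; rewrite mule_ge0// lee_fin.
apply: eq_fsbigr => y; rewrite inE => -[x _ <-].
have y0 : (0 <= h n x)%R by [].
under [RHS]eq_integral do rewrite -muleA.
have mh : measurable (h n @^-1` [set h n x]) by [].
rewrite ge0_integralZl//; last exact/measurable_EFinP.
rewrite ge0_integralZl//; last 2 first.
- by apply: emeasurable_funM => //; exact/measurable_EFinP.
- by move=> z _; rewrite mule_ge0// lee_fin.
congr (_ * _); rewrite integral_indic// setIT nuE//.
rewrite integral_mkcond; apply: eq_integral => z _.
rewrite patchE indicE; by case: ifPn => _; rewrite ?mul1e ?mul0e.
Qed.

End Density.

(** * Tonelli's theorem for power measures *)

Section PowerMeasureTheory.
Context d (T : measurableType d) (R : realType).
Variable mu : {sigma_finite_measure set T -> \bar R}.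
Local Open Scope ereal_scope.

Definition rcons_unpair n (x : n.+1.-tuple T) : n.-tuple T * T :=
  ([tuple tnth x (widen_ord (leqnSn n) i) | i < n], tnth x ord_max).

Lemma rcons_pairK n : cancel (@rcons_pair _ T n) (@rcons_unpair n).
Proof.
move=> [t y]; congr pair.
  apply: eq_from_tnth => i; rewrite tnth_mktuple !(tnth_nth y)/= nth_rcons.
  by rewrite size_tuple ltn_ord.
by rewrite (tnth_nth y)/= nth_rcons size_tuple ltnn eqxx.
Qed.

Lemma measurable_rcons_unpair n :
  measurable_fun [set: n.+1.-tuple T] (@rcons_unpair n).
Proof.
apply: measurable_fun_pair; last exact: measurable_tnth.
apply/measurable_fun_tnthP => i.
rewrite (_ : _ \o _ = (@tnth _ T)^~ (widen_ord (leqnSn n) i)).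
  exact: measurable_tnth.
by apply/funext => x/=; rewrite tnth_mktuple.
Qed.

Lemma measurable_rcons n (g : n.+1.-tuple T -> \bar R) (x : n.-tuple T) :
  measurable_fun setT g -> measurable_fun setT (fun y => g [tuple of rcons x y]).
Proof.
move=> mg; apply: (measurableT_comp (f := g) (g := fun y => rcons_pair (x, y))) => //.
by apply: measurableT_comp; [exact: measurable_rcons_pair|exact: pair1_measurable].
Qed.

Lemma measurable_integral_rcons n (g : n.+1.-tuple T -> \bar R) :
  measurable_fun setT g -> (forall x, 0 <= g x) ->
  measurable_fun setT (fun x : n.-tuple T => \int[mu]_y g [tuple of rcons x y]).
Proof.
move=> mg g0.
apply: (@measurable_fun_fubini_tonelli_F _ _ _ _ _ mu (g \o @rcons_pair _ T n)).
  by apply: measurableT_comp => //; exact: measurable_rcons_pair.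
by move=> p /=.
Qed.

Section SnocMeasure.
Variables (n : nat) (nu : {measure set (n.-tuple T) -> \bar R}).
Hypothesis nu_sigma_finite : sigma_finite setT nu.

(* Tonelli's theorem asks for a sigma-finite structure on both factors; the
   copy [nu'] of [nu] carries it. *)
Let nu0 : set (n.-tuple T) -> \bar R := nu.
HB.instance Definition _ := Measure.copy nu0 nu.
HB.instance Definition _ :=
  Measure_isSigmaFinite.Build _ _ _ nu0 nu_sigma_finite.
Let nu' : {sigma_finite_measure set (n.-tuple T) -> \bar R} := nu0.

(** A sigma-finite exhaustion by rectangles is transported to tuples through
    the measurable inverse [rcons_unpair] of [rcons_pair]. *)
Lemma sigma_finite_snoc_measure : sigma_finite setT (snoc_measure nu mu).
Proof.
have /sigma_finiteP[F [FT ndF Foo]] := nu_sigma_finite.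
have /sigma_finiteP[G [GT ndG Goo]] := sigma_finiteT mu.
exists (fun i => @rcons_unpair n @^-1` (F i `*` G i)).
  rewrite -preimage_bigcup (_ : \bigcup_i _ = setT) ?preimage_setT//.
  apply/seteqP; split=> // -[x y] _.
  have [i _ Fix] : (\bigcup_i F i) x by rewrite -FT.
  have [j _ Gjy] : (\bigcup_i G i) y by rewrite -GT.
  exists (maxn i j) => //; split.
    by move: x Fix; exact/subsetPset/ndF/leq_maxl.
  by move: y Gjy; exact/subsetPset/ndG/leq_maxr.
move=> i; have [mF Fi] := Foo i; have [mG Gi] := Goo i; split.
  rewrite -[X in measurable X]setTI; apply: measurable_rcons_unpair => //.
  exact: measurableX.
rewrite /snoc_measure /pushforward -comp_preimage.
rewrite (_ : _ \o _ = id) ?preimage_id; last first.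
  by apply/funext => p; exact: rcons_pairK.
by rewrite product_measure1E// lte_mul_pinfty// ge0_fin_numE.
Qed.

Lemma ge0_integral_snoc_measure (g : n.+1.-tuple T -> \bar R) :
  measurable_fun setT g -> (forall x, 0 <= g x) ->
  \int[snoc_measure nu mu]_x g x =
  \int[nu]_x \int[mu]_y g [tuple of rcons x y].
Proof.
move=> mg g0.
transitivity (\int[(nu' \x mu)]_p (g \o @rcons_pair _ T n) p).
  by rewrite -(@ge0_integral_pushforward _ _ _ _ _ _
    (@measurable_rcons_pair _ T n) (nu' \x mu)%E setT).
rewrite fubini_tonelli1//=.
  by apply: measurableT_comp => //; exact: measurable_rcons_pair.
Qed.

End SnocMeasure.

Lemma sigma_finite_power_measure n : sigma_finite setT (power_measure mu n).
Proof.
elim: n => [|n]; last exact: sigma_finite_snoc_measure.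
exists (fun=> setT) => [|_]; first by rewrite bigcup_const.
by split=> //; rewrite /= diracT; exact: ltry.
Qed.

(** Tonelli's theorem in the form used throughout: integrate out the last
    observation first. *)
Lemma ge0_integral_power_measureS n (g : n.+1.-tuple T -> \bar R) :
  measurable_fun setT g -> (forall x, 0 <= g x) ->
  \int[power_measure mu n.+1]_x g x =
  \int[power_measure mu n]_x \int[mu]_y g [tuple of rcons x y].
Proof. by apply: ge0_integral_snoc_measure; exact: sigma_finite_power_measure. Qed.

End PowerMeasureTheory.

(** * Continuation and stopping weights *)

(** Prefixes of a tuple have sizes of the form [minn i n] that only
    propositionally equal [i]; a size-indexed family of functions cannot see
    the difference. *)
Lemma eq_tuple_fun (A U : Type) (F : forall n, n.-tuple A -> U) m n
    (s : m.-tuple A) (t : n.-tuple A) : s = t :> seq A -> F m s = F n t.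
Proof.
move=> st; have mn : m = n by rewrite -(size_tuple s) -(size_tuple t) st.
by case: n / mn t st => t st; congr F; exact/val_inj.
Qed.

Section Continuation.
Context d (T : measurableType d) (R : realType).
Variable psi : forall n, n.-tuple T -> R.

Lemma measurable_take_tuple n i :
  measurable_fun setT (fun x : n.-tuple T => [tuple of take i x]).
Proof.
apply/measurable_fun_tnthP => j.
have jn : (j < n)%N by rewrite (leq_trans (ltn_ord j))// geq_minr.
rewrite (_ : _ \o _ = (@tnth _ T)^~ (Ordinal jn)); first exact: measurable_tnth.
apply/funext => x; have y := tnth x (Ordinal jn).
by rewrite /= !(tnth_nth y)/= nth_take// (leq_trans (ltn_ord j))// geq_minl.
Qed.

Lemma continuation1 (x : 1.-tuple T) : continuation psi x = 1.
Proof. by rewrite /continuation big_geq. Qed.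

Lemma continuation_rcons n (x : n.-tuple T) y : (0 < n)%N ->
  continuation psi [tuple of rcons x y] = continuation psi x * (1 - psi x).
Proof.
move=> n0; rewrite /continuation big_nat_recr//=; congr (_ * (1 - _)).
  apply: eq_big_nat => i /andP[_ ltin]; congr (1 - _).
  apply: eq_tuple_fun => /=.
  by rewrite -cats1 takel_cat// size_tuple ltnW.
apply: eq_tuple_fun; rewrite /= -cats1 takel_cat ?size_tuple//.
by rewrite take_oversize// size_tuple.
Qed.

Hypothesis psiP : stopping_rule psi.

Let minn_gt0 n i : i \in index_iota 1 n -> (0 < minn i n)%N.
Proof.
rewrite mem_index_iota => /andP[i0 ltin].
by rewrite leq_min i0 (leq_trans i0 (ltnW ltin)).
Qed.

Lemma continuation_ge0 n (x : n.-tuple T) : 0 <= continuation psi x.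
Proof.
rewrite /continuation big_seq; apply: prodr_ge0 => i in1.
by have [_ /(_ [tuple of take i x])/andP[_]] := psiP (minn_gt0 in1); rewrite subr_ge0.
Qed.

Lemma measurable_continuation n :
  measurable_fun setT (@continuation _ _ _ psi n).
Proof.
apply: measurable_prod => i in1.
apply: measurable_funB => //; have [mpsi _] := psiP (minn_gt0 in1).
apply: measurableT_comp mpsi _; exact: measurable_take_tuple.
Qed.

Lemma stopping_at_ge0 n (x : n.-tuple T) : (0 < n)%N -> 0 <= stopping_at psi x.
Proof.
move=> n0; rewrite mulr_ge0 ?continuation_ge0//.
by have [_ /(_ x)/andP[]] := psiP n0.
Qed.

Lemma measurable_stopping_at n : (0 < n)%N ->
  measurable_fun setT (@stopping_at _ _ _ psi n).
Proof.
move=> n0; apply: measurable_funM; first exact: measurable_continuation.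
by have [] := psiP n0.
Qed.

End Continuation.

(** * Observations and the mean stopping time *)

Section Observation.
Context d (T : measurableType d) (R : realType).
Context d' (Omega : measurableType d').
Variables (P : probability Omega R) (X : nat -> {mfun Omega >-> T}).
Local Open Scope ereal_scope.

Lemma measurable_observation n : measurable_fun setT (observation X n).
Proof.
apply/measurable_fun_tnthP => i.
rewrite (_ : _ \o _ = X i.+1); first exact: measurable_funPT.
by apply/funext => w; rewrite /= tnth_mktuple.
Qed.

Lemma observationS n w :
  observation X n.+1 w = [tuple of rcons (observation X n w) (X n.+1 w)].
Proof.
apply: eq_from_tnth => i; rewrite tnth_mktuple.
have [ltin | leni] := ltnP i n.
  rewrite (tnth_nth (X n.+1 w))/= nth_rcons size_map size_enum_ord ltin.
  rewrite (nth_map (Ordinal ltin)) ?size_enum_ord//.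
  by rewrite (nth_ord_enum _ (Ordinal ltin)).
have -> : i = ord_max by apply/val_inj/anti_leq; rewrite /= leni -ltnS ltn_ord.
by rewrite (tnth_nth (X n.+1 w))/= nth_rcons size_map size_enum_ord ltnn eqxx.
Qed.

(** The law of the first [n] observations has density [f n], so expectations
    become integrals with respect to the power measure. *)
Lemma Eobs_density (mu : {sigma_finite_measure set T -> \bar R})
    (f : forall n, n.-tuple T -> R) n (F : n.-tuple T -> R) :
    has_densities mu P X f -> (0 < n)%N ->
    measurable_fun setT F -> (forall x, (0 <= F x)%R) ->
  Eobs P X F = \int[power_measure mu n]_x (F x * f n x)%:E.
Proof.
move=> hf n0 mF F0; have [mf f0 Pf] := hf n n0.
have mobs := @measurable_observation n.
rewrite /Eobs expectation.unlock.
transitivity (\int[pushforward P (observation X n)]_x (F x)%:E).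
  rewrite (ge0_integral_pushforward mobs)//; first exact/measurable_EFinP.
  by move=> x _; rewrite lee_fin.
rewrite (ge0_integral_density (m := power_measure mu n) mf f0)//.
exact/measurable_EFinP.
Qed.

Section StoppingTime.
Variable psi : forall n, n.-tuple T -> R.
Hypothesis psiP : stopping_rule psi.

(** The probability that the stopping time is at least [n]. *)
Definition prob_continue n := Eobs P X (@continuation _ _ _ psi n).

Let p := prob_stop_at P X psi.
Let q := prob_continue.

Lemma prob_stop_at_ge0 n : (0 < n)%N -> 0 <= p n.
Proof.
move=> n0; apply: expectation_ge0 => w; exact: stopping_at_ge0.
Qed.

Lemma prob_continue_ge0 n : 0 <= q n.
Proof. apply: expectation_ge0 => w; exact: continuation_ge0. Qed.

Lemma prob_continue1 : q 1 = 1.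
Proof.
rewrite /q /prob_continue /Eobs (_ : (fun _ => _) = cst 1%R) ?expectation_cst//.
by apply/funext => w; rewrite continuation1.
Qed.

(** Given survival up to stage [n], either the test stops there or the factor
    [1 - psi n] of the next continuation weight is collected. *)
Lemma prob_continueD n : (0 < n)%N -> q n = p n + q n.+1.
Proof.
move=> n0; rewrite /q /prob_continue /p /prob_stop_at /Eobs expectation.unlock.
rewrite -ge0_integralD//.
- apply: eq_integral => w _; rewrite -EFinD; congr EFin.
  by rewrite observationS continuation_rcons// /stopping_at mulrBr mulr1 addrC subrK.
- by move=> w _; rewrite lee_fin stopping_at_ge0.
- apply/measurable_EFinP; apply: measurableT_comp (measurable_observation (n := n)).
  exact: measurable_stopping_at.
- by move=> w _; rewrite lee_fin continuation_ge0.
- apply/measurable_EFinP; apply: measurableT_comp (measurable_observation (n := n.+1)).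
  exact: measurable_continuation.
Qed.

Lemma prob_continue_le1 n : (0 < n)%N -> q n <= 1.
Proof.
case: n => // n _; elim: n => [|n IH]; first by rewrite prob_continue1.
apply: le_trans IH; rewrite [leRHS]prob_continueD//.
by rewrite leeDr// prob_stop_at_ge0.
Qed.

Lemma prob_continue_fin_num n : (0 < n)%N -> q n \is a fin_num.
Proof.
move=> n0; rewrite ge0_fin_numE ?prob_continue_ge0//.
by rewrite (le_lt_trans (prob_continue_le1 n0))// ltry.
Qed.

Lemma sum_prob_stop_at n :
  \sum_(1 <= i < n.+1) p i + q n.+1 = 1.
Proof.
elim: n => [|n IH]; first by rewrite big_geq// add0e prob_continue1.
by rewrite big_nat_recr//= -addeA -prob_continueD.
Qed.

(** Summation by parts, from [prob_continueD]: the partial sums of the two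
    formulas for the mean stopping time differ by the boundary term
    [n * prob_continue n.+1]. *)
Lemma sum_prob_continue n : \sum_(1 <= i < n.+1) q i =
  \sum_(1 <= i < n.+1) i%:R%:E * p i + n%:R%:E * q n.+1.
Proof.
elim: n => [|n IH]; first by rewrite !big_geq// mul0e adde0.
rewrite big_nat_recr//= IH [in RHS]big_nat_recr//= -!addeA; congr (_ + _).
rewrite (_ : _ + q n.+1 = n.+1%:R%:E * q n.+1); last first.
  by rewrite -natr1 EFinD ge0_muleDl ?lee_fin// mul1e.
by rewrite [q n.+1]prob_continueD// ge0_muleDr ?prob_stop_at_ge0 ?prob_continue_ge0//.
Qed.

Let np_ge0 n : (0 < n)%N -> 0 <= n%:R%:E * p n.
Proof. by move=> n0; rewrite mule_ge0 ?lee_fin// prob_stop_at_ge0. Qed.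

(** When stopping is almost sure, [prob_continue m.+1] is the tail
    [\sum_(m < i) p i], so the boundary term of the summation by parts is at
    most the tail of [\sum_i i * p i]. *)
Lemma sum_prob_continue_le_asn :
  prob_stop P X psi = 1 ->
  \sum_(1 <= n <oo) q n <= \sum_(1 <= n <oo) n%:R%:E * p n.
Proof.
move=> p1; apply: lime_le.
  by apply: is_cvg_nneseries => n _ _; exact: prob_continue_ge0.
apply: nearW => -[|m]; first rewrite big_geq// nneseries_ge0//.
  by move=> n n1 _; exact: np_ge0.
rewrite sum_prob_continue.
rewrite [leRHS](nneseries_split _ m)//= add1n.
have pfin : \sum_(1 <= i < m.+1) p i \is a fin_num.
  rewrite ge0_fin_numE; last first.
    by rewrite big_nat sume_ge0// => i /andP[i0 _]; exact: prob_stop_at_ge0.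
  rewrite (@le_lt_trans _ _ 1) ?ltry// -(sum_prob_stop_at m) leeDl//.
  exact: prob_continue_ge0.
have -> : q m.+1 = \sum_(m.+1 <= i <oo) p i.
  have cancelp x : \sum_(1 <= i < m.+1) p i + x = 1 ->
    x = 1 - \sum_(1 <= i < m.+1) p i by move=> <-; rewrite [X in _ = X - _]addeC addeK.
  rewrite (cancelp _ (sum_prob_stop_at m)); apply/esym/cancelp.
  rewrite -p1 /prob_stop [RHS](nneseries_split _ m) ?add1n// => i.
  exact: prob_stop_at_ge0.
rewrite leeD2l// !(@eseries_cond _ _ _ m.+1) -nneseriesZl; last first.
  by move=> i /= mi; apply: prob_stop_at_ge0; exact: leq_trans mi.
apply: lee_nneseries => i.
  move=> _ /= mi; rewrite mule_ge0 ?lee_fin// prob_stop_at_ge0//.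
  exact: leq_trans mi.
move=> /= mi; rewrite lee_wpmul2r ?prob_stop_at_ge0 ?(leq_trans _ mi)//.
by rewrite lee_fin ler_nat ltnW.
Qed.

(** The terms of a convergent series tend to zero, and [prob_continue n] is the
    mass that has not yet stopped. *)
Lemma prob_stop_eq1 : \sum_(1 <= n <oo) q n < +oo -> prob_stop P X psi = 1.
Proof.
rewrite (@eseries_cond _ _ _ 1) => qoo.
have q0 : q n @[n --> \oo] --> 0.
  have := nneseries_tail_cvg qoo (fun k _ => prob_continue_ge0 k).
  apply: (squeeze_cvge _ (cvg_cst 0)); near=> n.
  have n0 : (0 < n)%N by near: n; exists 1%N.
  rewrite prob_continue_ge0/=.
  have := @nneseries_lim_ge R q (fun k => 0 < k)%N n n.+1.
  by rewrite big_mkcond big_nat1 n0; apply => k _ _; exact: prob_continue_ge0.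
apply/cvg_lim => //.
have : (1 - q n) @[n --> \oo] --> 1 - 0.
  by apply: cvgeB => //; exact: cvg_cst.
rewrite sube0; apply: cvg_trans; apply: near_eq_cvg; near=> n.
have n0 : (0 < n)%N by near: n; exists 1%N.
rewrite -(sum_prob_stop_at n.-1) prednK// addeK//.
exact: prob_continue_fin_num.
Unshelve. all: by end_near. Qed.

Lemma asn_le_sum_prob_continue :
  \sum_(1 <= n <oo) n%:R%:E * p n <= \sum_(1 <= n <oo) q n.
Proof.
apply: lime_le; first by apply: is_cvg_nneseries => n n0 _; exact: np_ge0.
apply: nearW => -[|m].
  by rewrite big_geq// nneseries_ge0// => n _ _; exact: prob_continue_ge0.
apply: (@le_trans _ _ (\sum_(1 <= n < m.+1) q n)).
  rewrite sum_prob_continue leeDl// mule_ge0 ?lee_fin//.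
  exact: prob_continue_ge0.
by apply: nneseries_lim_ge => n _ _; exact: prob_continue_ge0.
Qed.

(** The tail-sum formula for the mean stopping time. It needs no case
    distinction: if the test may run forever, both sides are infinite. *)
Lemma average_sample_numberE :
  average_sample_number P X psi = \sum_(1 <= n <oo) q n.
Proof.
apply/le_anti/andP; split; rewrite /average_sample_number.
  have [->|q_neq] := eqVneq (\sum_(1 <= n <oo) q n) +oo; first exact: leey.
  rewrite prob_stop_eq1 ?eqxx ?lt_neqAle ?q_neq ?leey//.
  exact: asn_le_sum_prob_continue.
by case: ifPn => [/eqP/sum_prob_continue_le_asn//|_]; exact: leey.
Qed.

End StoppingTime.
End Observation.

(** * Optimal stopping *)

(** The marginal property of a family of densities, in the weak form in which it
    enters Bellman's recursion: integrals of functions of the first [n]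
    observations agree whether computed with [f n] or with [f n.+1]. *)
Definition consistent_densities d (T : measurableType d) (R : realType)
    (mu : {sigma_finite_measure set T -> \bar R})
    (f : forall n, n.-tuple T -> R) : Prop :=
  forall n (F : n.-tuple T -> R) (G : n.+1.-tuple T -> R), (0 < n)%N ->
    measurable_fun setT F -> measurable_fun setT G ->
    (forall x, 0 <= F x) -> (forall x, 0 <= G x) ->
    (forall (x : n.-tuple T) y, G [tuple of rcons x y] = F x) ->
    (\int[power_measure mu n]_x (F x * f n x)%:E =
     \int[power_measure mu n.+1]_x (G x * f n.+1 x)%:E)%E.

Section OptimalValue.
Context d (T : measurableType d) (R : realType).
Variable mu : {sigma_finite_measure set T -> \bar R}.
Variable l : forall n, n.-tuple T -> \bar R.
Variable f : forall n, n.-tuple T -> R.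
Local Open Scope ereal_scope.

Hypothesis l_meas : forall n, (0 < n)%N -> measurable_fun setT (@l n).
Hypothesis l_ge0 : forall n (x : n.-tuple T), (0 < n)%N -> 0 <= l x.
Hypothesis l_lty : forall n (x : n.-tuple T), (0 < n)%N -> l x < +oo.
Hypothesis l_int :
  forall n, (0 < n)%N -> \int[power_measure mu n]_x l x < +oo.
Hypothesis f_meas : forall n, (0 < n)%N -> measurable_fun setT (@f n).
Hypothesis f_ge0 : forall n (x : n.-tuple T), (0 < n)%N -> (0 <= f x)%R.

Let fE_meas n : (0 < n)%N -> measurable_fun setT (EFin \o @f n).
Proof. by move=> n0; apply/measurable_EFinP; exact: f_meas. Qed.

Let B r n (x : n.-tuple T) := backward mu l f r x.
Let V n (x : n.-tuple T) := Vlim mu l f x.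

Lemma backward_ge0 r n (x : n.-tuple T) : (0 < n)%N -> 0 <= B r x.
Proof.
rewrite /B; elim: r n x => [|r IH] n x n0 /=; first exact: l_ge0.
rewrite le_min l_ge0//= adde_ge0 ?lee_fin ?f_ge0//.
by apply: integral_ge0 => y _; exact: IH.
Qed.

Lemma backward_le_stop r n (x : n.-tuple T) : B r x <= l x.
Proof. by case: r => //= r; rewrite /B/= ge_min lexx. Qed.

Lemma measurable_backward r n :
  (0 < n)%N -> measurable_fun setT (@B r n).
Proof.
rewrite /B; elim: r n => [|r IH] n n0 /=; first exact: l_meas.
apply: measurable_mine; first exact: l_meas.
apply: emeasurable_funD; first exact: fE_meas.
apply: measurable_integral_rcons => [|x]; first exact: IH.
exact: backward_ge0.
Qed.

Lemma backward_noninc n (x : n.-tuple T) : (0 < n)%N ->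
  {homo (fun r => B r x) : r s / (r <= s)%N >-> s <= r}.
Proof.
move=> n0; apply/nonincreasing_seqP => r; rewrite /B.
elim: r n x n0 => [|r IH] n x n0; first exact: (backward_le_stop 1).
rewrite [leLHS]/= [leRHS]/= le_min ge_min lexx/= ge_min; apply/orP; right.
rewrite leeD2l//; apply: ge0_le_integral => //.
- by move=> y _; exact: (@backward_ge0 r.+1 n.+1 [tuple of rcons x y]).
- by apply: (measurable_rcons (g := @B r.+1 n.+1)); exact: measurable_backward.
- by apply: (measurable_rcons (g := @B r n.+1)); exact: measurable_backward.
- by move=> y _; exact: IH.
Qed.

Lemma cvg_backward n (x : n.-tuple T) : (0 < n)%N ->
  B r x @[r --> \oo] --> V x.
Proof.
move=> n0; have /cvgP Bcvg := ereal_nonincreasing_cvgn (@backward_noninc n x n0).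
suff -> : V x = limn (fun r => B r x) by [].
apply/cvg_lim => //; rewrite -(cvg_shiftn n)/=.
rewrite (_ : (fun _ => _) = fun r => B r x)//.
by apply/funext => r; rewrite /Vtrunc addnK.
Qed.

Lemma Vlim_le_backward r n (x : n.-tuple T) : (0 < n)%N -> V x <= B r x.
Proof.
move=> n0; rewrite -(cvg_lim _ (@cvg_backward n x n0))//.
apply: lime_le; first exact: (cvgP _ (@cvg_backward n x n0)).
by near=> s; apply: backward_noninc => //; near: s; exact: nbhs_infty_ge.
Unshelve. all: by end_near. Qed.

Lemma Vlim_le_stop n (x : n.-tuple T) : (0 < n)%N -> V x <= l x.
Proof. exact: (@Vlim_le_backward 0). Qed.

Lemma Vlim_ge0 n (x : n.-tuple T) : (0 < n)%N -> 0 <= V x.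
Proof.
move=> n0; rewrite -(cvg_lim _ (@cvg_backward n x n0))//.
apply: lime_ge; first exact: (cvgP _ (@cvg_backward n x n0)).
by apply: nearW => r; exact: backward_ge0.
Qed.

Lemma measurable_Vlim n : (0 < n)%N -> measurable_fun setT (@V n).
Proof.
move=> n0; apply: (emeasurable_fun_cvg (fun r => @B r n)).
  by move=> r; exact: measurable_backward.
by move=> x _; exact: cvg_backward.
Qed.

Lemma Rcont_ge0 n (x : n.-tuple T) : 0 <= Rcont mu l f x.
Proof. by apply: integral_ge0 => y _; exact: Vlim_ge0. Qed.

Lemma measurable_Rcont n : measurable_fun setT (@Rcont _ _ _ mu l f n).
Proof.
apply: measurable_integral_rcons => [|x]; first exact: measurable_Vlim.
exact: Vlim_ge0.
Qed.

(** Supplies the dominating function for the passage to the limit in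
    [ae_Bellman]; by Tonelli the exceptional set is null. *)
Lemma ae_integral_rcons_lty n :
  {ae power_measure mu n, forall x : n.-tuple T, \int[mu]_y l [tuple of rcons x y] < +oo}.
Proof.
have lS := l_meas (ltn0Sn n).
have int_rcons : (power_measure mu n).-integrable setT
    (fun x : n.-tuple T => \int[mu]_y l [tuple of rcons x y]).
  apply/integrableP; split.
    by apply: measurable_integral_rcons => // x; exact: l_ge0.
  under eq_integral => x _.
    rewrite gee0_abs; last by apply: integral_ge0 => y _; exact: l_ge0.
    over.
  rewrite -ge0_integral_power_measureS//; first exact: l_int.
  by move=> x; exact: l_ge0.
apply: filterS (integrable_ae measurableT int_rcons) => x /(_ I).
by rewrite ge0_fin_numE//; apply: integral_ge0 => y _; exact: l_ge0.
Qed.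

(** Bellman's equation: the backward recursion passes to the limit. The
    truncated values decrease to [V], and for almost every [x] they are
    dominated by the integrable function [y |-> l (rcons x y)], so the
    integral of the limit is the limit of the integrals. *)
Lemma ae_Bellman n : (0 < n)%N -> {ae power_measure mu n, forall x,
  V x = Order.min (l x) ((f x)%:E + Rcont mu l f x)}.
Proof.
move=> n0; apply: filterS (@ae_integral_rcons_lty n) => x lxoo.
have cvgR : \int[mu]_y B r [tuple of rcons x y] @[r --> \oo] -->
    Rcont mu l f x.
  apply: (@dominated_cvg _ _ _ mu setT measurableT _ _
    (fun y => l [tuple of rcons x y])).
  - by move=> r; apply: (measurable_rcons (g := @B r n.+1)); exact: measurable_backward.
  - by move=> y _; exact: cvg_backward.
  - by move=> y _; rewrite ge0_fin_numE ?l_lty ?l_ge0.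
  - apply/integrableP; split.
      by apply: (measurable_rcons (g := @l n.+1)); exact: l_meas.
    under eq_integral do rewrite gee0_abs ?l_ge0//.
    exact: lxoo.
  - move=> r y _; rewrite gee0_abs ?backward_ge0//; exact: backward_le_stop.
apply/le_anti/andP; split.
- rewrite le_min Vlim_le_stop//=.
  have : (f x)%:E + \int[mu]_y B r [tuple of rcons x y] @[r --> \oo] -->
      (f x)%:E + Rcont mu l f x.
    by apply: cvgeD => //; exact: cvg_cst.
  move=> /[dup] cvgD /cvg_lim <-//; apply: lime_ge; first exact: cvgP cvgD.
  apply: nearW => r; apply: (le_trans (@Vlim_le_backward r.+1 n x n0)).
  by rewrite /B/= ge_min lexx orbT.
- rewrite -(cvg_lim _ (@cvg_backward n x n0))//.
  apply: lime_ge; first exact: (cvgP _ (@cvg_backward n x n0)).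
  apply: nearW => -[|r]; first by rewrite ge_min lexx.
  rewrite /B/= le_min !ge_min lexx/=; apply/orP; right.
  rewrite leeD2l//; apply: ge0_le_integral => //.
  + by move=> y _; exact: Vlim_ge0.
  + by apply: (measurable_rcons (g := @V n.+1)); exact: measurable_Vlim.
  + by apply: (measurable_rcons (g := @B r n.+1)); exact: measurable_backward.
  + by move=> y _; exact: Vlim_le_backward.
Qed.

Hypothesis f_consistent : consistent_densities mu f.

Variable psi : forall n, n.-tuple T -> R.
Hypothesis psiP : stopping_rule psi.

Definition stopped_loss n :=
  \int[power_measure mu n]_x ((stopping_at psi x)%:E * l x).

Definition continuation_mass n :=
  \int[power_measure mu n]_x (continuation psi x * f x)%:E.

Definition continuation_value n :=
  \int[power_measure mu n]_x ((continuation psi x)%:E * V x).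

(** The expected cost when [psi] is followed before stage [n] and decisions are
    optimal from stage [n] on: losses already incurred, one unit for each
    observation made so far, and the optimal value of what remains. *)
Definition truncated_cost n := \sum_(1 <= i < n) stopped_loss i
  + \sum_(1 <= i < n.+1) continuation_mass i + continuation_value n.

Definition Bellman_min n (x : n.-tuple T) :=
  Order.min (l x) ((f x)%:E + Rcont mu l f x).

(** The conditional excess cost of deciding with [psi] instead of optimally at
    stage [n]. Only the finite quantity [Bellman_min] is subtracted, so the
    formula makes sense also where [Rcont] is infinite. *)
Definition regret n (x : n.-tuple T) : \bar R :=
  (psi x)%:E * (l x - Bellman_min x)
  + (1 - psi x)%:E * ((f x)%:E + Rcont mu l f x - Bellman_min x).

Let psi_itv n (x : n.-tuple T) : (0 < n)%N -> (0 <= psi x <= 1)%R.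
Proof. by move=> n0; have [_ ->] := psiP n0. Qed.

Let psi_meas n : (0 < n)%N -> measurable_fun setT (@psi n).
Proof. by move=> n0; have [] := psiP n0. Qed.

Lemma continue_ge0 n (x : n.-tuple T) : (0 < n)%N ->
  0 <= (f x)%:E + Rcont mu l f x.
Proof. by move=> n0; rewrite adde_ge0 ?lee_fin ?f_ge0 ?Rcont_ge0. Qed.

Lemma measurable_continue n : (0 < n)%N ->
  measurable_fun setT (fun x : n.-tuple T => (f x)%:E + Rcont mu l f x).
Proof.
by move=> n0; apply: emeasurable_funD; [exact: fE_meas|exact: measurable_Rcont].
Qed.

Lemma Bellman_min_ge0 n (x : n.-tuple T) : (0 < n)%N -> 0 <= Bellman_min x.
Proof. by move=> n0; rewrite le_min l_ge0//= continue_ge0. Qed.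

Lemma Bellman_min_fin_num n (x : n.-tuple T) : (0 < n)%N ->
  Bellman_min x \is a fin_num.
Proof.
move=> n0; rewrite ge0_fin_numE ?Bellman_min_ge0//.
by rewrite (le_lt_trans _ (l_lty x n0))// ge_min lexx.
Qed.

Lemma measurable_Bellman_min n : (0 < n)%N ->
  measurable_fun setT (@Bellman_min n).
Proof.
by move=> n0; apply: measurable_mine; [exact: l_meas|exact: measurable_continue].
Qed.

Let stop_gap_ge0 n (x : n.-tuple T) : (0 < n)%N -> 0 <= l x - Bellman_min x.
Proof.
by move=> n0; rewrite sube_ge0 ?ge_min ?lexx// Bellman_min_fin_num// orbT.
Qed.

Let continue_gap_ge0 n (x : n.-tuple T) : (0 < n)%N ->
  0 <= (f x)%:E + Rcont mu l f x - Bellman_min x.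
Proof.
by move=> n0; rewrite sube_ge0 ?ge_min ?lexx ?orbT// Bellman_min_fin_num// orbT.
Qed.

Lemma regret_ge0 n (x : n.-tuple T) : (0 < n)%N -> 0 <= regret x.
Proof.
move=> n0; have /andP[p0 p1] := psi_itv x n0.
rewrite adde_ge0// mule_ge0 ?stop_gap_ge0 ?continue_gap_ge0// lee_fin//.
by rewrite subr_ge0.
Qed.

Lemma measurable_regret n : (0 < n)%N -> measurable_fun setT (@regret n).
Proof.
move=> n0; have pm := psi_meas n0.
have mm := measurable_Bellman_min n0.
apply: emeasurable_funD; apply: emeasurable_funM.
- exact/measurable_EFinP.
- by apply: emeasurable_funB => //; exact: l_meas.
- by apply/measurable_EFinP; exact: measurable_funB.
- by apply: emeasurable_funB => //; exact: measurable_continue.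
Qed.

Lemma regretE n (x : n.-tuple T) : (0 < n)%N ->
  (psi x)%:E * l x + (1 - psi x)%:E * ((f x)%:E + Rcont mu l f x) =
  Bellman_min x + regret x.
Proof.
move=> n0; have /andP[p0 p1] := psi_itv x n0.
have q0 : (0 <= 1 - psi x)%R by rewrite subr_ge0.
have m0 := Bellman_min_ge0 x n0; have mfin := Bellman_min_fin_num x n0.
have split_gap a t : 0 <= a - Bellman_min x -> (0 <= t)%R ->
    t%:E * a = t%:E * (a - Bellman_min x) + t%:E * Bellman_min x.
  by move=> a0 t0; rewrite -ge0_muleDr// subeK.
rewrite (split_gap _ _ (stop_gap_ge0 x n0) p0).
rewrite (split_gap _ _ (continue_gap_ge0 x n0) q0) addeACA [RHS]addeC.
congr (_ + _); rewrite -ge0_muleDl ?lee_fin// -EFinD addrC subrK.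
by rewrite mul1e.
Qed.

(** Following [psi] for one more stage costs exactly the integrated regret of
    that stage. The new terms [stopped_loss n], [continuation_mass n.+1] and
    [continuation_value n.+1] are brought down to integrals over the first
    [n] observations by the marginal property and Tonelli; there they add up
    to the left-hand side of [regretE], and [ae_Bellman] identifies
    [Bellman_min] with [V]. *)
Lemma truncated_costS n : (0 < n)%N -> truncated_cost n.+1 =
  truncated_cost n +
  \int[power_measure mu n]_x ((continuation psi x)%:E * regret x).
Proof.
move=> n0; have pm := psi_meas n0.
have cm := @measurable_continuation _ _ _ _ psiP n.
have sm := @measurable_stopping_at _ _ _ _ psiP n n0.
have c0 := @continuation_ge0 _ _ _ _ psiP n.
have s0 x := @stopping_at_ge0 _ _ _ _ psiP n x n0.
have f0 x := @f_ge0 n x n0.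
have R0 x := @Rcont_ge0 n x.
have V0 x := @Vlim_ge0 n x n0.
have q0 (x : n.-tuple T) : (0 <= 1 - psi x)%R.
  by have /andP[_] := @psi_itv n x n0; rewrite subr_ge0.
have Vm := measurable_Vlim n0; have Rm := @measurable_Rcont n.
have qm : measurable_fun setT (fun x : n.-tuple T => (1 - psi x)%R).
  exact: measurable_funB.
have massS : continuation_mass n.+1 = \int[power_measure mu n]_x
    (continuation psi x * (1 - psi x) * f x)%:E.
  rewrite /continuation_mass -(@f_consistent n
    (fun x => continuation psi x * (1 - psi x))%R)//.
  - exact: measurable_funM.
  - exact: measurable_continuation.
  - by move=> x; rewrite mulr_ge0.
  - by move=> x; exact: continuation_ge0.
  - by move=> x y; rewrite continuation_rcons.
have valueS : continuation_value n.+1 = \int[power_measure mu n]_x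
    ((continuation psi x * (1 - psi x))%:E * Rcont mu l f x).
  rewrite /continuation_value ge0_integral_power_measureS//; last 2 first.
  - apply: emeasurable_funM; last exact: measurable_Vlim.
    by apply/measurable_EFinP; exact: measurable_continuation.
  - move=> x; rewrite mule_ge0 ?Vlim_ge0// lee_fin.
    exact: continuation_ge0.
  apply: eq_integral => x _; under eq_integral do rewrite continuation_rcons//.
  rewrite ge0_integralZl//.
  - by apply: (measurable_rcons (g := @V n.+1)); exact: measurable_Vlim.
  - by move=> y _; exact: Vlim_ge0.
  - by rewrite lee_fin mulr_ge0.
have min0 x := @Bellman_min_ge0 n x n0.
have reg0 x := @regret_ge0 n x n0.
have minm := measurable_Bellman_min n0; have regm := measurable_regret n0.
have lm := l_meas n0; have l0 x := @l_ge0 n x n0; have fm := f_meas n0.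
have cmE : measurable_fun setT (fun x : n.-tuple T => (continuation psi x)%:E).
  exact/measurable_EFinP.
have dm : measurable_fun setT
    (fun x : n.-tuple T => (continuation psi x * (1 - psi x))%R).
  exact: measurable_funM.
have d0 (x : n.-tuple T) : (0 <= continuation psi x * (1 - psi x))%R.
  exact: mulr_ge0.
have stop_m : measurable_fun setT
    (fun x : n.-tuple T => (stopping_at psi x)%:E * l x).
  by apply: emeasurable_funM => //; exact/measurable_EFinP.
have mass_m : measurable_fun setT (fun x : n.-tuple T =>
    (continuation psi x * (1 - psi x) * f x)%:E).
  by apply/measurable_EFinP; exact: measurable_funM.
have rest_m : measurable_fun setT (fun x : n.-tuple T =>
    (continuation psi x * (1 - psi x))%:E * Rcont mu l f x).
  by apply: emeasurable_funM => //; exact/measurable_EFinP.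
have min_m := emeasurable_funM cmE minm.
have reg_m := emeasurable_funM cmE regm.
have stop_0 (x : n.-tuple T) : 0 <= (stopping_at psi x)%:E * l x.
  by rewrite mule_ge0 ?lee_fin.
have mass_0 (x : n.-tuple T) :
    0 <= (continuation psi x * (1 - psi x) * f x)%:E.
  by rewrite lee_fin mulr_ge0.
have rest_0 (x : n.-tuple T) :
    0 <= (continuation psi x * (1 - psi x))%:E * Rcont mu l f x.
  by rewrite mule_ge0 ?lee_fin.
have min_0 (x : n.-tuple T) : 0 <= (continuation psi x)%:E * Bellman_min x.
  by rewrite mule_ge0 ?lee_fin.
have reg_0 (x : n.-tuple T) : 0 <= (continuation psi x)%:E * regret x.
  by rewrite mule_ge0 ?lee_fin.
have valueE : continuation_value n =
    \int[power_measure mu n]_x ((continuation psi x)%:E * Bellman_min x).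
  apply: ge0_ae_eq_integral => //; first exact: emeasurable_funM.
  - by move=> x _; rewrite mule_ge0 ?lee_fin.
  - by apply: filterS (ae_Bellman n0) => x VE _; rewrite /Bellman_min -VE.
have step : stopped_loss n + (continuation_mass n.+1 + continuation_value n.+1)
    = continuation_value n +
    \int[power_measure mu n]_x ((continuation psi x)%:E * regret x).
  rewrite massS valueS valueE -!ge0_integralD//; last 2 first.
  - by move=> x _; rewrite adde_ge0.
  - exact: emeasurable_funD.
  apply: eq_integral => x _.
  have /andP[p0 _] := psi_itv x n0.
  rewrite -ge0_muleDr// -regretE// [RHS]ge0_muleDr; last 2 first.
  - by rewrite mule_ge0 ?lee_fin.
  - by rewrite mule_ge0 ?lee_fin// continue_ge0.
  by rewrite !muleA -!EFinM [in RHS]ge0_muleDr ?lee_fin.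
rewrite /truncated_cost big_nat_recr//= [X in _ + X + _]big_nat_recr//=.
move: (stopped_loss n) (continuation_mass n.+1) (continuation_value n.+1) step.
move: (continuation_value n) (integral _ _ _) => w r a q w'.
by rewrite addeACA -!addeA => ->.
Qed.

(** The regret puts weight [psi] on the excess of stopping and [1 - psi] on the
    excess of continuing; at most one of these excesses is nonzero, and it must
    carry no weight. *)
Lemma regret_eq0 n (x : n.-tuple T) : (0 < n)%N ->
  regret x = 0 <->
  (\1_[set z : n.-tuple T | (l z < (f z)%:E + Rcont mu l f z)%E] x <= psi x <=
   \1_[set z : n.-tuple T | (l z <= (f z)%:E + Rcont mu l f z)%E] x)%R.
Proof.
move=> n0; have /andP[p0 p1] := @psi_itv n x n0.
have indE (Q : n.-tuple T -> bool) : (\1_[set z | Q z] x = (Q x)%:R :> R)%R.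
  by rewrite indicE; congr (_%:R); congr nat_of_bool; apply/idP/idP; rewrite inE.
rewrite !indE /regret /Bellman_min.
have := @Bellman_min_fin_num n x n0; rewrite /Bellman_min.
set a := l x; set b := (f x)%:E + _.
case: (ltgtP a b) => [ab|ba|ab] minfin.
- rewrite subee// mule0 add0e.
  have gap : b - a != 0 by rewrite gt_eqF// sube_gt0.
  split=> [/eqP|].
    rewrite mule_eq0 (negbTE gap) orbF eqe subr_eq0 => /eqP <-.
    by rewrite lexx.
  by move=> /le_anti <-; rewrite subrr mul0e.
- rewrite subee// mule0 adde0.
  have gap : a - b != 0 by rewrite gt_eqF// sube_gt0.
  split=> [/eqP|].
    by rewrite mule_eq0 (negbTE gap) orbF eqe => /eqP ->; rewrite lexx.
  by move=> /le_anti <-; rewrite mul0e.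
- by rewrite -ab subee// !mule0 adde0 p0 p1.
Qed.

Lemma regret_integral_eq0P :
  (forall n, (0 < n)%N ->
     \int[power_measure mu n]_x ((continuation psi x)%:E * regret x) = 0) <->
  threshold_stopping mu l f psi.
Proof.
have regE n : (0 < n)%N ->
    \int[power_measure mu n]_x ((continuation psi x)%:E * regret x) = 0 <->
    {ae power_measure mu n, forall x : n.-tuple T,
      Cset psi x -> regret x = 0}.
  move=> n0.
  have c0 := @continuation_ge0 _ _ _ _ psiP n.
  have reg_m : measurable_fun setT
      (fun x : n.-tuple T => (continuation psi x)%:E * regret x).
    apply: emeasurable_funM; last exact: measurable_regret.
    by apply/measurable_EFinP; exact: measurable_continuation.
  have reg_0 (x : n.-tuple T) : 0 <= (continuation psi x)%:E * regret x.
    by rewrite mule_ge0 ?lee_fin ?regret_ge0.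
  have := ae_eq_integral_abs (power_measure mu n) measurableT reg_m.
  under eq_integral do rewrite gee0_abs//.
  move=> ->; split; apply: filterS => x /=.
    move=> /(_ I)/eqP; rewrite /Cset/= mule_eq0.
    by case/orP => [/eqP[->]|/eqP//]; rewrite ltxx.
  move=> Cx _; have [->|cx0] := eqVneq (continuation psi x) 0%R.
    by rewrite mul0e.
  by rewrite Cx ?mule0// /Cset/= lt0r cx0 c0.
split=> [reg0 n n0|thr n n0].
- have /(regE n n0) := reg0 n n0.
  by apply: filterS => x regx Cx; apply/regret_eq0 => //; exact: regx.
- apply/(regE n n0); have := thr n n0.
  by apply: filterS => x thrx Cx; apply/regret_eq0 => //; exact: thrx.
Qed.

(** The first observation is always taken, so no stopping rule enters here. *)
Definition optimal_cost := \int[power_measure mu 1]_x (f x)%:E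
  + \int[power_measure mu 1]_x V x.

Lemma truncated_cost1 : truncated_cost 1 = optimal_cost.
Proof.
rewrite /truncated_cost big_geq// big_nat1 add0e; congr (_ + _).
  by apply: eq_integral => x _; rewrite continuation1 mul1r.
by apply: eq_integral => x _; rewrite continuation1 mul1e.
Qed.

Lemma optimal_cost_lty : \int[power_measure mu 1]_x (f x)%:E < +oo ->
  optimal_cost < +oo.
Proof.
move=> f1; rewrite lte_add_pinfty//; apply: le_lt_trans (l_int (ltnSn 0)).
apply: ge0_le_integral => //.
- by move=> x _; exact: Vlim_ge0.
- exact: measurable_Vlim.
- exact: l_meas.
- by move=> x _; exact: Vlim_le_stop.
Qed.

Lemma stopped_loss_ge0 n : (0 < n)%N -> 0 <= stopped_loss n.
Proof.
move=> n0; apply: integral_ge0 => x _; rewrite mule_ge0 ?l_ge0// lee_fin.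
exact: stopping_at_ge0.
Qed.

Lemma continuation_mass_ge0 n : (0 < n)%N -> 0 <= continuation_mass n.
Proof.
move=> n0; apply: integral_ge0 => x _; rewrite lee_fin mulr_ge0 ?f_ge0//.
exact: continuation_ge0.
Qed.

Lemma continuation_value_ge0 n : (0 < n)%N -> 0 <= continuation_value n.
Proof.
move=> n0; apply: integral_ge0 => x _; rewrite mule_ge0 ?Vlim_ge0// lee_fin.
exact: continuation_ge0.
Qed.

(** With [continuation_mass n] in the role of the probability of reaching stage
    [n], the second sum is the mean stopping time. *)
Definition total_cost := \sum_(1 <= n <oo) stopped_loss n
  + \sum_(1 <= n <oo) continuation_mass n.

Lemma truncated_cost_nondecreasing m n : (0 < m <= n)%N ->
  truncated_cost m <= truncated_cost n.
Proof.
move=> /andP[m0 /subnKC <-]; elim: (n - m)%N => [|r IH]; first by rewrite addn0.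
have mr0 : (0 < m + r)%N by rewrite addn_gt0 m0.
rewrite addnS truncated_costS// (le_trans IH)// leeDl//.
apply: integral_ge0 => x _; rewrite mule_ge0 ?regret_ge0// lee_fin.
exact: continuation_ge0.
Qed.

Lemma optimal_cost_le_truncated_cost n : (0 < n)%N ->
  optimal_cost <= truncated_cost n.
Proof. by move=> n0; rewrite -truncated_cost1 truncated_cost_nondecreasing. Qed.

Lemma truncated_cost_threshold n : threshold_stopping mu l f psi -> (0 < n)%N ->
  truncated_cost n = optimal_cost.
Proof.
move=> /regret_integral_eq0P reg0; case: n => // n _.
elim: n => [|n IH]; first by rewrite truncated_cost1.
by rewrite truncated_costS// reg0// adde0.
Qed.

(** The cost accumulated up to stage [n] is at most [truncated_cost n], which
    for a threshold rule never grows beyond its initial value. *)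
Lemma total_cost_threshold : threshold_stopping mu l f psi ->
  total_cost <= optimal_cost.
Proof.
move=> thr; rewrite /total_cost -nneseriesD; last 2 first.
- by move=> n n0 _; exact: stopped_loss_ge0.
- by move=> n n0 _; exact: continuation_mass_ge0.
apply: lime_le.
  apply: is_cvg_nneseries => n n0 _.
  by rewrite adde_ge0 ?stopped_loss_ge0 ?continuation_mass_ge0.
apply: nearW => n; rewrite big_split/=.
rewrite -(truncated_cost_threshold thr (ltn0Sn n)) -[leLHS]adde0.
rewrite /truncated_cost; apply: leeD; last exact: continuation_value_ge0.
apply: leeD.
  by apply: lee_sum_nneg_natr => // i i0 _; exact: stopped_loss_ge0.
apply: lee_sum_nneg_natr => [i i0 _|]; first exact: continuation_mass_ge0.
exact: leqW.
Qed.

(** The value of continuing optimally is at most that of stopping at once, so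
    [truncated_cost n] exceeds the cost accumulated up to [n] by at most the
    integral assumed to vanish; by monotonicity the bound improves as [n]
    grows. *)
Lemma truncated_cost_le_total n : (0 < n)%N ->
  \int[power_measure mu k]_x ((continuation psi x)%:E * l x)
    @[k --> \oo] --> 0 ->
  truncated_cost n <= total_cost.
Proof.
move=> n0 cl0.
have cost_le k : truncated_cost k.+1 <= total_cost +
    \int[power_measure mu k.+1]_x ((continuation psi x)%:E * l x).
  rewrite /truncated_cost; apply: leeD; first apply: leeD.
  - by apply: nneseries_lim_ge => i i0 _; exact: stopped_loss_ge0.
  - by apply: nneseries_lim_ge => i i0 _; exact: continuation_mass_ge0.
  have c0 := @continuation_ge0 _ _ _ _ psiP k.+1.
  have cm : measurable_fun setT
      (fun x : k.+1.-tuple T => (continuation psi x)%:E).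
    by apply/measurable_EFinP; exact: measurable_continuation.
  apply: ge0_le_integral => //.
  - by move=> x _; rewrite mule_ge0 ?lee_fin ?Vlim_ge0.
  - by apply: emeasurable_funM => //; exact: measurable_Vlim.
  - by apply: emeasurable_funM => //; exact: l_meas.
  - by move=> x _; rewrite lee_wpmul2l ?lee_fin ?Vlim_le_stop.
rewrite -[leRHS]adde0.
have : total_cost + \int[power_measure mu k]_x ((continuation psi x)%:E * l x)
    @[k --> \oo] --> total_cost + 0.
  by apply: cvgeD => //; [exact: fin_num_adde_defl|exact: cvg_cst].
move=> /[dup] cvgT /cvg_lim <-//; apply: lime_ge; first exact: cvgP cvgT.
near=> k; have nk : (n <= k)%N by near: k; exact: nbhs_infty_ge.
have k0 := leq_trans n0 nk.
rewrite -(prednK k0) (le_trans _ (cost_le k.-1))// prednK//.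
by rewrite truncated_cost_nondecreasing// n0.
Unshelve. all: by end_near. Qed.

(** If the total cost is the optimal one, the nondecreasing sequence of
    truncated costs is squeezed to a constant, and its finite increments, the
    integrated regrets, vanish. *)
Lemma optimal_threshold :
  optimal_cost < +oo ->
  \int[power_measure mu k]_x ((continuation psi x)%:E * l x)
    @[k --> \oo] --> 0 ->
  total_cost <= optimal_cost -> threshold_stopping mu l f psi.
Proof.
move=> opt_lty cl0 totle; apply/regret_integral_eq0P => n n0.
have costE k : (0 < k)%N -> truncated_cost k = optimal_cost.
  move=> k0; apply/le_anti; rewrite optimal_cost_le_truncated_cost// andbT.
  exact: le_trans (truncated_cost_le_total k0 cl0) totle.
have opt_fin : optimal_cost \is a fin_num.
  rewrite ge0_fin_numE// adde_ge0//; apply: integral_ge0 => x _.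
    by rewrite lee_fin f_ge0.
  exact: Vlim_ge0.
have := truncated_costS n0; rewrite !costE//.
move=> /(congr1 (fun z => z - optimal_cost)).
by rewrite subee// [in RHS](addeC optimal_cost) addeK.
Qed.

End OptimalValue.

(** * Series of nonnegative terms with positive indices *)

Section SeriesFromOne.
Context (R : realType).
Local Open Scope ereal_scope.
Implicit Types u v : (\bar R)^nat.

(* Terms of index 0 are unconstrained below, so positivity and equality are
   only assumed for positive indices. *)

Lemma eq_eseries1 u v : (forall n, (0 < n)%N -> u n = v n) ->
  \sum_(1 <= n <oo) u n = \sum_(1 <= n <oo) v n.
Proof.
move=> uv; congr (limn _); apply/funext => m.
by apply: eq_big_nat => n /andP[n0 _]; exact: uv.
Qed.

Lemma le_nneseries1 u v : (forall n, (0 < n)%N -> 0 <= u n) ->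
    (forall n, (0 < n)%N -> u n <= v n) ->
  \sum_(1 <= n <oo) u n <= \sum_(1 <= n <oo) v n.
Proof.
move=> u0 uv; rewrite [leLHS]eseries_cond [leRHS]eseries_cond.
by apply: lee_nneseries => n /=; [move=> _; exact: u0|exact: uv].
Qed.

Lemma nneseries1_sumZ (I : finType) (a : I -> R) (u : I -> (\bar R)^nat) :
    (forall i, 0 <= a i)%R -> (forall i n, (0 < n)%N -> 0 <= u i n) ->
  \sum_i (a i)%:E * \sum_(1 <= n <oo) u i n =
  \sum_(1 <= n <oo) \sum_i (a i)%:E * u i n.
Proof.
move=> a0 u0; rewrite [RHS]eseries_cond [RHS]eseries_mkcond.
pose w i n := if (0 < n)%N then (a i)%:E * u i n else 0.
rewrite (_ : (fun m => _) = fun m => \sum_(0 <= n < m) \sum_i w i n).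
  rewrite nneseries_sum; last first.
    by move=> i n _; rewrite /w; case: ifPn => // n0; rewrite mule_ge0 ?lee_fin ?u0.
  apply: eq_bigr => i _; rewrite [in LHS]eseries_cond -nneseriesZl; last first.
    by move=> n n0; exact: u0.
  by rewrite eseries_mkcond.
apply/funext => m; apply: eq_bigr => n _; rewrite /w /=.
by case: ifPn => // _; rewrite big1.
Qed.

End SeriesFromOne.

(** * Decision losses and weighted errors *)

Section MinLoss.
Context d (T : measurableType d) (R : realType).
Variables (k : nat) (lambda : 'I_k -> 'I_k -> R).
Variable fH : 'I_k -> forall n, n.-tuple T -> R.
Hypothesis lambda_gt0 : forall i j : 'I_k, i != j -> 0 < lambda i j.
Hypothesis fH_ge0 : forall i n (x : n.-tuple T), (0 < n)%N -> 0 <= fH i x.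
Hypothesis fH_meas : forall i n, (0 < n)%N -> measurable_fun setT (@fH i n).
Local Open Scope ereal_scope.

Let D j n (x : n.-tuple T) := decision_loss lambda fH j x.
Let l n (x : n.-tuple T) := min_loss lambda fH x.

Lemma decision_loss_ge0 j n (x : n.-tuple T) : (0 < n)%N -> 0 <= D j x.
Proof.
move=> n0; rewrite lee_fin sumr_ge0// => i ij.
by rewrite mulr_ge0 ?fH_ge0// ltW// lambda_gt0.
Qed.

Lemma measurable_decision_loss j n : (0 < n)%N -> measurable_fun setT (@D j n).
Proof.
move=> n0; apply/measurable_EFinP.
under eq_fun do rewrite -big_filter.
by apply: measurable_sum => i; apply: measurable_funM => //; exact: fH_meas.
Qed.

Lemma min_loss_le j n (x : n.-tuple T) : l x <= D j x.
Proof. exact: bigmin_le. Qed.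

Lemma min_loss_ge0 n (x : n.-tuple T) : (0 < n)%N -> 0 <= l x.
Proof.
move=> n0; apply: le_bigmin => [|j _]; first exact: leey.
exact: decision_loss_ge0.
Qed.

Lemma measurable_min_loss n : (0 < n)%N -> measurable_fun setT (@l n).
Proof.
move=> n0; rewrite /l /min_loss; elim: (index_enum _) => [|j s IH].
  by under eq_fun do rewrite big_nil; exact: measurable_cst.
under eq_fun do rewrite big_cons.
by apply: measurable_mine => //; exact: measurable_decision_loss.
Qed.

Hypothesis k_gt0 : (0 < k)%N.

Lemma min_loss_lty n (x : n.-tuple T) : l x < +oo.
Proof. by rewrite (le_lt_trans (min_loss_le (Ordinal k_gt0) x))// ltry. Qed.

Definition average_loss (phi : forall n, 'I_k -> n.-tuple T -> R) n
    (x : n.-tuple T) : \bar R := \sum_(j < k) (phi n j x)%:E * D j x.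

Lemma min_loss_le_average phi n (x : n.-tuple T) : (0 < n)%N ->
  decision_rule phi -> l x <= average_loss phi x.
Proof.
move=> n0 phiP; have [_ phi0 phi1] := phiP n n0.
rewrite -[leLHS]mul1e -[in leLHS](phi1 x) -sumEFin ge0_sume_distrl; last first.
  by move=> j _; rewrite lee_fin.
by apply: lee_sum => j _; rewrite lee_wpmul2l ?lee_fin// min_loss_le.
Qed.

(** A decision with positive weight has minimal loss, so the average of the
    losses is the minimal one. *)
Lemma min_loss_average phi n (x : n.-tuple T) : (0 < n)%N ->
  decision_rule phi ->
  (forall j, phi n j x <= \1_[set z : n.-tuple T | D j z = l z] x)%R ->
  average_loss phi x = l x.
Proof.
move=> n0 phiP phimin; have [_ phi0 phi1] := phiP n n0.
rewrite -[RHS]mul1e -[in RHS](phi1 x) -sumEFin ge0_sume_distrl; last first.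
  by move=> j _; rewrite lee_fin.
apply: eq_bigr => j _; have := phimin j; rewrite indicE.
case: (boolP (x \in _)) => [/set_mem/= -> //|_ phi_le0].
suff -> : phi n j x = 0%R by rewrite !mul0e.
by apply/le_anti; rewrite phi_le0 phi0.
Qed.

End MinLoss.

Section WeightedError.
Context d (T : measurableType d) (R : realType).
Context d' (Omega : measurableType d').
Variable mu : {sigma_finite_measure set T -> \bar R}.
Variables (k : nat) (lambda : 'I_k -> 'I_k -> R).
Variable PH : 'I_k -> probability Omega R.
Variable X : nat -> {mfun Omega >-> T}.
Variable fH : 'I_k -> forall n, n.-tuple T -> R.
Hypothesis lambda_gt0 : forall i j : 'I_k, i != j -> 0 < lambda i j.
Hypothesis fHP : forall i, has_densities mu (PH i) X (fH i).
Variable psi : forall n, n.-tuple T -> R.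
Variable phi : forall n, 'I_k -> n.-tuple T -> R.
Hypotheses (psiP : stopping_rule psi) (phiP : decision_rule phi).
Local Open Scope ereal_scope.

(** Extending the weights by zero to the diagonal lets sums run over all pairs
    of hypotheses. *)
Definition error_weight (ij : 'I_k * 'I_k) : R :=
  if ij.1 != ij.2 then lambda ij.1 ij.2 else 0%R.

Lemma error_weight_ge0 ij : (0 <= error_weight ij)%R.
Proof. by rewrite /error_weight; case: ifPn => // /lambda_gt0/ltW. Qed.

Definition weighted_error := \sum_(ij : 'I_k * 'I_k)
  (error_weight ij)%:E * error_prob (PH ij.1) X psi phi ij.2.

(** Tonelli for sums and integrals: collecting, for each accepted hypothesis
    [j], the weighted densities of the false ones produces the decision loss
    of [j]. *)
Lemma weighted_errorE : weighted_error = \sum_(1 <= n <oo)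
  \int[power_measure mu n]_x
    ((stopping_at psi x)%:E * average_loss lambda fH phi x).
Proof.
rewrite /weighted_error nneseries1_sumZ; last 2 first.
- exact: error_weight_ge0.
- move=> ij n n0; apply: expectation_ge0 => w.
  have [_ phi0 _] := phiP n0.
  by rewrite mulr_ge0 ?phi0//; exact: stopping_at_ge0.
apply: eq_eseries1 => n n0.
have [phim phi0 _] := phiP n0.
have sm := measurable_stopping_at psiP n0.
have s0 (x : n.-tuple T) := stopping_at_ge0 psiP x n0.
have fm i : measurable_fun setT (@fH i n) by have [] := fHP i n0.
have f0 i (x : n.-tuple T) : (0 <= fH i x)%R by have [_ ->] := fHP i n0.
have term_m (ij : 'I_k * 'I_k) : measurable_fun setT (fun x : n.-tuple T =>
    (stopping_at psi x * phi ij.2 x * fH ij.1 x)%:E).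
  apply/measurable_EFinP; apply: measurable_funM; last exact: fm.
  exact: measurable_funM.
have term_ge0 (ij : 'I_k * 'I_k) (x : n.-tuple T) :
    0 <= (stopping_at psi x * phi ij.2 x * fH ij.1 x)%:E.
  by rewrite lee_fin mulr_ge0// mulr_ge0.
under eq_bigr => ij _.
  rewrite (Eobs_density (fHP ij.1) n0); last 2 first.
  - exact: measurable_funM.
  - by move=> x; rewrite mulr_ge0.
  rewrite -ge0_integralZl//; last by rewrite lee_fin error_weight_ge0.
  over.
rewrite -ge0_integral_sum//; last 2 first.
- by move=> ij; apply: measurable_funeM; exact: term_m.
- by move=> ij x _; rewrite mule_ge0 ?term_ge0// lee_fin error_weight_ge0.
apply: eq_integral => x _.
rewrite /average_loss /decision_loss.
under eq_bigr do rewrite -EFinM.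
under [in RHS]eq_bigr do rewrite -EFinM.
rewrite !sumEFin -EFinM; congr EFin.
rewrite mulr_sumr -(pair_bigA _ (fun i j => error_weight (i, j) *
  (stopping_at psi x * phi j x * fH i x)))%R exchange_big/=.
apply: eq_bigr => j _; rewrite !mulr_sumr [RHS]big_mkcond/=.
apply: eq_bigr => i _; rewrite /error_weight/=; case: ifPn => // _.
  ring.
by rewrite mul0r.
Qed.

Let l n (x : n.-tuple T) := min_loss lambda fH x.

Let fH_ge0 i n (x : n.-tuple T) : (0 < n)%N -> (0 <= fH i x)%R.
Proof. by move=> n0; have [_ ->] := fHP i n0. Qed.

Let fH_meas i n : (0 < n)%N -> measurable_fun setT (@fH i n).
Proof. by move=> n0; have [] := fHP i n0. Qed.

Let loss_meas n : (0 < n)%N ->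
  measurable_fun setT (fun x : n.-tuple T => (stopping_at psi x)%:E * l x).
Proof.
move=> n0; apply: emeasurable_funM; last exact: measurable_min_loss.
by apply/measurable_EFinP; exact: measurable_stopping_at.
Qed.

Let average_meas n : (0 < n)%N -> measurable_fun setT (fun x : n.-tuple T =>
  (stopping_at psi x)%:E * average_loss lambda fH phi x).
Proof.
move=> n0; have [phim _ _] := phiP n0.
apply: emeasurable_funM.
  by apply/measurable_EFinP; exact: measurable_stopping_at.
apply: emeasurable_sum => j; apply: emeasurable_funM.
  by apply/measurable_EFinP; exact: phim.
exact: measurable_decision_loss.
Qed.

Let loss_ge0 n (x : n.-tuple T) : (0 < n)%N ->
  0 <= (stopping_at psi x)%:E * l x.
Proof.
move=> n0; rewrite mule_ge0 ?min_loss_ge0// lee_fin; exact: stopping_at_ge0.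
Qed.

Let loss_le_average n (x : n.-tuple T) : (0 < n)%N ->
  (stopping_at psi x)%:E * l x <=
  (stopping_at psi x)%:E * average_loss lambda fH phi x.
Proof.
move=> n0; rewrite lee_wpmul2l ?min_loss_le_average// lee_fin.
exact: stopping_at_ge0.
Qed.

Lemma stopped_loss_le_weighted_error :
  \sum_(1 <= n <oo) stopped_loss mu l psi n <= weighted_error.
Proof.
rewrite weighted_errorE; apply: le_nneseries1 => n n0.
  by apply: integral_ge0 => x _; exact: loss_ge0.
apply: ge0_le_integral => //.
- by move=> x _; exact: loss_ge0.
- exact: loss_meas.
- exact: average_meas.
- by move=> x _; exact: loss_le_average.
Qed.

Lemma weighted_error_min_loss : min_loss_decision mu lambda fH psi phi ->
  weighted_error = \sum_(1 <= n <oo) stopped_loss mu l psi n.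
Proof.
move=> phimin; rewrite weighted_errorE; apply: eq_eseries1 => n n0.
apply: ge0_ae_eq_integral => //.
- exact: average_meas.
- exact: loss_meas.
- move=> x _; exact: le_trans (loss_ge0 x n0) (loss_le_average x n0).
- by move=> x _; exact: loss_ge0.
have : {ae power_measure mu n, forall (x : n.-tuple T) (j : 'I_k),
    Sset psi x -> (phi j x <=
      \1_[set z | decision_loss lambda fH j z = min_loss lambda fH z] x)%R}.
  by apply: filter_forall => j; exact: phimin.
apply: filterS => x phix _.
have s0 := stopping_at_ge0 psiP x n0.
have [->|s_neq0] := eqVneq (stopping_at psi x) 0%R; first by rewrite !mul0e.
rewrite min_loss_average// => j; apply: phix.
by rewrite /Sset/= lt_neqAle eq_sym s_neq0.
Qed.

End WeightedError.

(** * The model *)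

Section DensityConsequences.
Context d (T : measurableType d) (R : realType).
Context d' (Omega : measurableType d').
Variable mu : {sigma_finite_measure set T -> \bar R}.
Variables (P : probability Omega R) (X : nat -> {mfun Omega >-> T}).
Variable f : forall n, n.-tuple T -> R.
Hypothesis fP : has_densities mu P X f.
Local Open Scope ereal_scope.

(** Both integrals are the expectation of the same random variable. *)
Lemma densities_consistent : consistent_densities mu f.
Proof.
move=> n F G n0 mF mG F0 G0 GF.
rewrite -(Eobs_density fP n0 mF F0) -(Eobs_density fP (ltn0Sn n) mG G0) /Eobs.
by congr expectation; apply/funext => w; rewrite observationS GF.
Qed.

Lemma integral_density n : (0 < n)%N -> \int[power_measure mu n]_x (f x)%:E = 1.
Proof.
move=> n0; have [_ _ /(_ setT measurableT) <-] := fP n0.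
by rewrite preimage_setT probability_setT.
Qed.

Lemma sum_continuation_massE psi : stopping_rule psi ->
  \sum_(1 <= n <oo) continuation_mass mu f psi n = average_sample_number P X psi.
Proof.
move=> psiP; rewrite average_sample_numberE//; apply: eq_eseries1 => n n0.
rewrite /prob_continue (Eobs_density fP n0)//.
- exact: measurable_continuation.
- exact: continuation_ge0.
Qed.

End DensityConsequences.

(** The loss of any fixed decision dominates, and it is a finite combination of
    probability densities. *)
Lemma integral_min_loss_lty d (T : measurableType d) (R : realType)
    d' (Omega : measurableType d') (mu : {sigma_finite_measure set T -> \bar R})
    (k : nat) (lambda : 'I_k -> 'I_k -> R) (PH : 'I_k -> probability Omega R)
    (X : nat -> {mfun Omega >-> T}) (fH : 'I_k -> forall n, n.-tuple T -> R) n :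
  (0 < k)%N -> (0 < n)%N -> (forall i j : 'I_k, i != j -> 0 < lambda i j) ->
  (forall i, has_densities mu (PH i) X (fH i)) ->
  (\int[power_measure mu n]_x min_loss lambda fH x < +oo)%E.
Proof.
move=> k0 n0 lambda0 fHP; pose j := Ordinal k0.
have fm i : measurable_fun setT (@fH i n) by have [] := fHP i n n0.
have f0 i (x : n.-tuple T) : 0 <= fH i n x by have [_ ->] := fHP i n n0.
apply: (@le_lt_trans _ _
    (\int[power_measure mu n]_x decision_loss lambda fH j x)%E).
  apply: ge0_le_integral => //.
  - by move=> x _; apply: min_loss_ge0 => // i m y m0; have [_ ->] := fHP i m m0.
  - by apply: measurable_min_loss => // i m m0; have [] := fHP i m m0.
  - by apply: measurable_decision_loss => // i m m0; have [] := fHP i m m0.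
  - by move=> x _; exact: min_loss_le.
pose w i := if i != j then lambda i j else 0.
have w0 i : 0 <= w i by rewrite /w; case: ifPn => // /lambda0/ltW.
under eq_integral => x _.
  rewrite /decision_loss big_mkcond/= -sumEFin.
  rewrite (eq_bigr (fun i => (w i)%:E * (fH i n x)%:E)%E); last first.
    by move=> i _; rewrite /w; case: ifP => // _; rewrite mul0e.
  over.
rewrite ge0_integral_sum//; last 2 first.
- by move=> i; apply: measurable_funeM; exact/measurable_EFinP.
- by move=> i x _; rewrite mule_ge0 ?lee_fin.
rewrite (eq_bigr (fun i => (w i)%:E)) ?sumEFin ?ltry// => i _.
rewrite ge0_integralZl// ?lee_fin//; last 2 first.
- exact/measurable_EFinP.
- by move=> x _; rewrite lee_fin.
by rewrite (integral_density (fHP i))// mule1.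
Qed.

(** * Optimality of the threshold test *)

Theorem theorem7 (R : realType) (k : nat) (hk : (2 <= k)%N)
  (d : measure_display) (T : measurableType d)
  (mu : {sigma_finite_measure set T -> \bar R})
  (d' : measure_display) (Omega : measurableType d')
  (Theta : Type) (P : Theta -> probability Omega R)
  (X : nat -> {mfun Omega >-> T})
  (f : Theta -> forall n : nat, n.-tuple T -> R)
  (hf : forall vt : Theta, has_densities mu (P vt) X (f vt))
  (thetaH : 'I_k -> Theta) (theta : Theta)
  (lambda : 'I_k -> 'I_k -> R)
  (hlambda : forall i j : 'I_k, i != j -> 0 < lambda i j)
  (l := @min_loss d T R k lambda (fun i : 'I_k => f (thetaH i)))
  (htrunc : truncatable mu (P theta) X l)
  (psi : forall n : nat, n.-tuple T -> R)
  (phi : forall n : nat, 'I_k -> n.-tuple T -> R)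
  (hpsi : stopping_rule psi) (hphi : decision_rule phi)
  (hpsi_thr : threshold_stopping mu l (f theta) psi)
  (hphi_min : min_loss_decision mu lambda (fun i : 'I_k => f (thetaH i)) psi phi)
  (psi' : forall n : nat, n.-tuple T -> R)
  (phi' : forall n : nat, 'I_k -> n.-tuple T -> R)
  (hpsi' : stopping_rule psi') (hphi' : decision_rule phi')
  (halpha : forall i j : 'I_k, i != j ->
     (error_prob (P (thetaH i)) X psi' phi' j
        <= error_prob (P (thetaH i)) X psi phi j)%E) :
  [/\ (average_sample_number (P theta) X psi
         <= average_sample_number (P theta) X psi')%E,
      (exists i j : 'I_k, i != j /\
         (error_prob (P (thetaH i)) X psi' phi' j
            < error_prob (P (thetaH i)) X psi phi j)%E) ->
      (average_sample_number (P theta) X psi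
         < average_sample_number (P theta) X psi')%E
    & (forall i j : 'I_k, i != j ->
         error_prob (P (thetaH i)) X psi' phi' j
           = error_prob (P (thetaH i)) X psi phi j) ->
      average_sample_number (P theta) X psi'
        = average_sample_number (P theta) X psi ->
      threshold_stopping mu l (f theta) psi'].
Proof.
have k_gt0 : (0 < k)%N by exact: ltnW.
pose PH i := P (thetaH i); pose fH i := f (thetaH i).
have fHP i : has_densities mu (PH i) X (fH i) by exact: hf.
have fH_ge0 i n (x : n.-tuple T) : (0 < n)%N -> 0 <= fH i n x.
  by move=> n0; have [_ ->] := fHP i n n0.
have fH_meas i n : (0 < n)%N -> measurable_fun setT (@fH i n).
  by move=> n0; have [] := fHP i n n0.
have f_ge0 n (x : n.-tuple T) : (0 < n)%N -> 0 <= f theta n x.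
  by move=> n0; have [_ ->] := hf theta n n0.
have f_meas n : (0 < n)%N -> measurable_fun setT (@f theta n).
  by move=> n0; have [] := hf theta n n0.
have l_meas n : (0 < n)%N -> measurable_fun setT (@l n).
  exact: measurable_min_loss.
have l_ge0 n (x : n.-tuple T) : (0 < n)%N -> (0 <= l n x)%E.
  exact: min_loss_ge0.
have l_lty n (x : n.-tuple T) : (0 < n)%N -> (l n x < +oo)%E.
  by move=> _; exact: min_loss_lty.
have l_int n : (0 < n)%N -> (\int[power_measure mu n]_x l n x < +oo)%E.
  by move=> n0; exact: (integral_min_loss_lty k_gt0 n0 hlambda fHP).
have f_cons := densities_consistent (hf theta).
have opt_lty : (optimal_cost mu l (f theta) < +oo)%E.
  apply: optimal_cost_lty => //; rewrite (integral_density (hf theta))//.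
  exact: ltry.
(* The Lagrangian [L + N] of a test: weighted errors plus mean sample number. *)
pose N psi := average_sample_number (P theta) X psi.
pose L psi phi := weighted_error lambda PH X psi phi.
have total_thr : (L psi phi + N psi <= optimal_cost mu l (f theta))%E.
  rewrite /L (weighted_error_min_loss hlambda fHP)//.
  rewrite /N -(sum_continuation_massE (hf theta))//.
  exact: total_cost_threshold.
have total_le : (total_cost mu l (f theta) psi' <= L psi' phi' + N psi')%E.
  rewrite /total_cost (sum_continuation_massE (hf theta))// leeD2r//.
  exact: (stopped_loss_le_weighted_error hlambda fHP).
(* Truncatability speaks only of rules with finite mean sample number. *)
have opt_le : (N psi' < +oo ->
    optimal_cost mu l (f theta) <= L psi' phi' + N psi')%E.
  move=> N'oo; apply: le_trans total_le.
  apply: (@le_trans _ _ (truncated_cost mu l (f theta) psi' 1)).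
    exact: optimal_cost_le_truncated_cost.
  by apply: truncated_cost_le_total => //; exact: htrunc.
have N_ge0 psi0 : stopping_rule psi0 -> (0 <= N psi0)%E.
  move=> psi0P; rewrite /N average_sample_numberE// nneseries_ge0// => n n0 _.
  exact: prob_continue_ge0.
have err_ge0 psi0 phi0 i j : stopping_rule psi0 -> decision_rule phi0 ->
    (0 <= error_prob (PH i) X psi0 phi0 j)%E.
  move=> psi0P phi0P; apply: nneseries_ge0 => n n0 _.
  apply: expectation_ge0 => w; have [_ phi0_ge0 _] := phi0P n n0.
  by rewrite mulr_ge0//; exact: stopping_at_ge0.
have L_ge0 psi0 phi0 : stopping_rule psi0 -> decision_rule phi0 ->
    (0 <= L psi0 phi0)%E.
  move=> psi0P phi0P; apply: sume_ge0 => ij _.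
  by rewrite mule_ge0 ?err_ge0// lee_fin error_weight_ge0.
have LN_lty := le_lt_trans total_thr opt_lty.
have L_fin : L psi phi \is a fin_num.
  rewrite ge0_fin_numE ?L_ge0// (le_lt_trans _ LN_lty)// leeDl//.
  exact: N_ge0.
have N_lty : (N psi < +oo)%E.
  by rewrite (le_lt_trans _ LN_lty)// leeDr// L_ge0.
have term_le (ij : 'I_k * 'I_k) :
    ((error_weight lambda ij)%:E * error_prob (PH ij.1) X psi' phi' ij.2 <=
     (error_weight lambda ij)%:E * error_prob (PH ij.1) X psi phi ij.2)%E.
  rewrite /error_weight; case: ifPn => [ij12|_]; last by rewrite !mul0e.
  by rewrite lee_wpmul2l ?halpha// lee_fin ltW// hlambda.
have L_le : (L psi' phi' <= L psi phi)%E by apply: lee_sum => ij _.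
have L'_fin : L psi' phi' \is a fin_num.
  by rewrite ge0_fin_numE ?L_ge0// (le_lt_trans L_le)// -ge0_fin_numE ?L_ge0.
split.
- have [N'oo|] := ltP (N psi') +oo%E; last first.
    by rewrite leye_eq /N => /eqP ->; exact: leey.
  rewrite -(leeD2lE _ _ L_fin) (le_trans total_thr)// (le_trans (opt_le N'oo))//.
  by rewrite leeD2r.
- move=> [i [j [ij alpha_lt]]].
  have [N'oo|] := ltP (N psi') +oo%E; last first.
    by rewrite leye_eq => /eqP; rewrite /N => ->.
  have L_lt : (L psi' phi' < L psi phi)%E.
    move: L'_fin; rewrite /L /weighted_error (bigD1 (i, j))//=.
    rewrite [in X in _ -> (_ < X)%E](bigD1 (i, j))//= fin_numD => /andP[_ rest_fin].
    apply: lte_leD => //; last by apply: lee_sum => ? _; exact: term_le.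
    rewrite /error_weight ij/= lte_pmul2l// ?lte_fin hlambda//.
  rewrite -(lteD2lE _ _ L_fin) (le_lt_trans total_thr)//.
  by rewrite (le_lt_trans (opt_le N'oo))// lteD2rE// ge0_fin_numE ?N_ge0.
- move=> _ NE; apply: optimal_threshold => //.
    by apply: htrunc => //; rewrite NE.
  apply: le_trans total_le _; apply: le_trans total_thr.
  by rewrite [N psi']NE leeD2r.
Qed.
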